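(* Let $\Sigma$ be an oriented cellular surface with face set $F$ and non-oriented edge set $E$, let $\theta\in(0,\pi)^E$, $\theta^*_e=\pi-\theta_e$, and $\Phi\in(0,\infty)^F$. Let $S_{Euc}$ and $S_{hyp}$ be the Euclidean and hyperbolic circle pattern functionals on $\mathbb R^F$ (defined in the context). Then the critical points of $S_{Euc}$ and $S_{hyp}$ correspond to the circle patterns with exterior intersection angles $\theta$ and cone (or boundary) angles $\Phi$ in the centers of the circles. That is: (a) $\rho\in\mathbb R^F$ is a critical point of $S_{Euc}$ if and only if the radii $r_f=e^{\rho_f}$ are the radii of a Euclidean circle pattern combinatorially equivalent to $\Sigma$ with exterior intersection angles $\theta$ and cone (or boundary) angles $\Phi_f$. (b) If $\rho\in\mathbb R^F$ is a critical point of $S_{hyp}$, then all $\rho_f$ are negative; and $\rho$ is a critical point of $S_{hyp}$ if and only if all $\rho_f<0$ and the radii $r_f>0$ determined by $\rho_f=\log\tanh(r_f/2)$ are the radii of a hyperbolic circle pattern combinatorially equivalent to $\Sigma$ with exterior intersection angles $\theta$ and cone (or boundary) angles $\Phi_f$.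
   Context: Cellular surfaces. A cellular surface is a cellular decomposition (up to homeomorphism) of a compact connected oriented surface, possibly with boundary, coming from a finite embedded graph. If the surface is closed, the complement of the graph is a disjoint union of open discs (faces). If it has boundary, the graph meets the boundary only in vertices, and the complement of the union of graph and boundary is a disjoint union of open discs; only edges of the embedded graph count as edges, so every edge has a face on its left and one on its right (possibly the same). $\vec E$ is the set of oriented edges; functions on $E$ are regarded as functions on $\vec E$ with equal values on $e$ and $-e$. The oriented boundary of $f$ consists of the oriented edges having $f$ on their left. Circle patterns. Given radii $r_f>0$, take for each edge $e$, with faces $f_j,f_k$ on its two sides, a Euclidean (resp. hyperbolic) kite with vertices, in cyclic order, center of $f_j$, one endpoint of $e$, center of $f_k$, other endpoint of $e$, with side lengths $r_{f_j},r_{f_k},r_{f_k},r_{f_j}$ and angle $\theta_e$ at both vertices corresponding to endpoints of $e$. Gluing the kites according to $\Sigma$ gives a surface of curvature $0$ (resp. $-1$) with cone-like singularities: a circle pattern combinatorially equivalent to $\Sigma$ with exterior intersection angles $\theta$. For an oriented edge $e$ with $f_j$ on its left and $f_k$ on its right, $\varphi_e\in(0,\pi)$ denotes half the kite angle at the center of $f_j$. In terms of $\rho_f=\log r_f$ (Euclidean) or $\rho_f=\log\tanh(r_f/2)$ (hyperbolic), $$\varphi_e=\frac1{2i}\log\frac{1-e^{\rho_{f_k}-\rho_{f_j}-i\theta_e}}{1-e^{\rho_{f_k}-\rho_{f_j}+i\theta_e}}\quad\text{(Euclidean)},$$ $$\varphi_e=\frac1{2i}\log\frac{1-e^{\rho_{f_k}-\rho_{f_j}-i\theta_e}}{1-e^{\rho_{f_k}-\rho_{f_j}+i\theta_e}}-\frac1{2i}\log\frac{1-e^{\rho_{f_k}+\rho_{f_j}-i\theta_e}}{1-e^{\rho_{f_k}+\rho_{f_j}+i\theta_e}}\quad\text{(hyperbolic)}.$$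 The pattern has cone (or boundary) angles $\Phi_f$ in the centers iff $\Phi_f=2\sum\varphi_e$ for every $f$, the sum over the oriented boundary of $f$. Functionals. $\operatorname{Li}_2$ is the dilogarithm, $\operatorname{Li}_2(z)=-\int_0^z\frac{\log(1-\zeta)}{\zeta}d\zeta$ on $\mathbb C\setminus[1,\infty)$. For $\rho\in\mathbb R^F$, $$S_{Euc}(\rho)=\sum_{e\in E}\Big(\operatorname{Im}\operatorname{Li}_2(e^{\rho_{f_k}-\rho_{f_j}+i\theta_e})+\operatorname{Im}\operatorname{Li}_2(e^{\rho_{f_j}-\rho_{f_k}+i\theta_e})-\theta^*_e(\rho_{f_j}+\rho_{f_k})\Big)+\sum_{f\in F}\Phi_f\rho_f,$$ $$S_{hyp}(\rho)=\sum_{e\in E}\Big(\operatorname{Im}\operatorname{Li}_2(e^{\rho_{f_k}-\rho_{f_j}+i\theta_e})+\operatorname{Im}\operatorname{Li}_2(e^{\rho_{f_j}-\rho_{f_k}+i\theta_e})+\operatorname{Im}\operatorname{Li}_2(e^{\rho_{f_j}+\rho_{f_k}+i\theta_e})+\operatorname{Im}\operatorname{Li}_2(e^{-\rho_{f_j}-\rho_{f_k}+i\theta_e})\Big)+\sum_{f\in F}\Phi_f\rho_f,$$ where $f_j,f_k$ are the faces on the two sides of $e$. *)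

(* Defs.v *)
From HB Require Import structures.
From mathcomp Require Import all_boot all_order all_algebra all_fingroup.
From mathcomp Require Import all_classical all_reals all_analysis.
From mathcomp Require Import complex.

Set Implicit Arguments.
Unset Strict Implicit.
Unset Printing Implicit Defensive.

Import Order.TTheory GRing.Theory Num.Theory.
Import numFieldNormedType.Exports.

Local Open Scope classical_set_scope.
Local Open Scope complex_scope.
Local Open Scope ring_scope.

(* The surface is presented by cutting it open along the graph: a disjoint
   union of oriented polygons, one for each face, whose sides are the oriented
   edges and the boundary arcs; the two orientations of an edge are glued to
   each other and the boundary arcs are left free.
   - [edge] carries a reference orientation: [(e, true)] is [e] with that
     orientation and [(e, false)] is [-e], so [edge * bool] is the set of
     oriented edges.
   - [arc] consists of the arcs into which the vertices cut the boundary; they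
     are not edges.
   - [next] maps a side to the following one, counterclockwise, on the polygon
     of the face [lface] on its left.  The oriented boundary of [f] is thus
     the set of [d : edge * bool] with [lface (inl d) = f].
   - Connectedness of the surface is connectedness of its face-adjacency graph.
   [lface] need not be onto, but by [lface_connect] a face without sides is the
   only one: the sphere with a single vertex and no edge, or the closed disc
   with the empty graph.  A closed surface is one whose [arc] is empty. *)
Record cellular_surface := CellularSurface {
  edge : finType;
  arc : finType;
  face : finType;
  next : {perm (edge * bool + arc)};
  lface : edge * bool + arc -> face;
  face_nonempty : (0 < #|face|)%N;
  lface_orbit : forall x y, (lface x == lface y) = (y \in porbit next x);
  lface_connect : forall f g : face,
    connect [rel f1 f2 | [exists d : edge * bool,
       (lface (inl d) == f1) && (lface (inl (d.1, ~~ d.2)) == f2)]] f g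
}.

Section Geometry.
Variable R : realType.

(* [angle q p s] is the unoriented angle at [p] between the directions of [q]
   and [s]; [ccw p q s] says that the triangle [p, q, s] is nondegenerate and
   positively oriented. *)
Record plane := Plane {
  point :> Type;
  dist : point -> point -> R;
  angle : point -> point -> point -> R;
  ccw : point -> point -> point -> bool
}.

Definition vangle n (B : 'rV[R]_n -> 'rV[R]_n -> R) (u v : 'rV[R]_n) : R :=
  acos (B u v / (Num.sqrt (B u u) * Num.sqrt (B v v))).

Definition dot n (u v : 'rV[R]_n) : R := \sum_i u 0 i * v 0 i.

(* The library norm on row vectors is the sup norm, hence [dot]. *)
Definition euclidean_plane : plane := {|
  point := 'rV[R]_2;
  dist := fun p q => Num.sqrt (dot (q - p) (q - p));
  angle := fun q p s => vangle (@dot 2) (q - p) (s - p);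
  ccw := fun p q s =>
    0 < (q - p) 0 0 * (s - p) 0 1 - (q - p) 0 1 * (s - p) 0 0
|}.

Definition lorentz (u v : 'rV[R]_3) : R :=
  - (u 0 0 * v 0 0) + u 0 1 * v 0 1 + u 0 2 * v 0 2.

(* The hyperboloid model; the time coordinate comes first. *)
Definition hyperboloid : Type :=
  {x : 'rV[R]_3 | (lorentz x x == -1) && (0 < x 0 0)}.

Definition arcosh (t : R) : R := ln (t + Num.sqrt (t ^+ 2 - 1)).

(* The initial velocity at [p], up to a positive factor, of the geodesic from
   [p] to [q]. *)
Definition direction (p q : hyperboloid) : 'rV[R]_3 :=
  \val q + lorentz (\val p) (\val q) *: \val p.

Definition hyperbolic_plane : plane := {|
  point := hyperboloid;
  dist := fun p q => arcosh (- lorentz (\val p) (\val q));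
  angle := fun q p s => vangle lorentz (direction p q) (direction p s);
  ccw := fun p q s =>
    0 < \det (\matrix_(i < 3) tnth [tuple \val p; \val q; \val s] i)
|}.

(* The kite of an oriented edge: the centers of the circles on its left and on
   its right, and its initial and terminal endpoints. *)
Record kite (X : plane) := Kite {
  center_l : X;
  source : X;
  center_r : X;
  target : X
}.

(* The vertices [center_l, source, center_r, target] follow each other
   counterclockwise: the axis from [center_l] to [center_r] cuts the kite into
   two positively oriented triangles. *)
Definition is_kite (X : plane) (rl rr theta : R) (K : kite X) : Prop :=
  [/\ [/\ dist (center_l K) (source K) = rl,
          dist (source K) (center_r K) = rr,
          dist (center_r K) (target K) = rr
        & dist (target K) (center_l K) = rl],
      angle (center_l K) (source K) (center_r K) = theta,
      angle (center_r K) (target K) (center_l K) = theta,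
      ccw (center_l K) (source K) (center_r K)
    & ccw (center_r K) (target K) (center_l K)].

(* The interior angle of the kite at its left ([b = true]) or right
   ([b = false]) center.  It may exceed [pi], so it is the sum of the angles of
   the two triangles cut out by the axis. *)
Definition center_angle (X : plane) (K : kite X) (b : bool) : R :=
  if b then
    angle (source K) (center_l K) (center_r K)
    + angle (center_r K) (center_l K) (target K)
  else
    angle (target K) (center_r K) (center_l K)
    + angle (center_l K) (center_r K) (source K).

Section Patterns.
Variables (X : plane) (S : cellular_surface).

(* Around the center of [f], the kites are glued along their sides joining the
   center to a vertex, all of which have length [r f]; hence the kites of the
   edges determine the glued surface. *)
Definition circle_pattern (theta : edge S -> R) (r : face S -> R)
    (K : edge S -> kite X) : Prop :=
  forall e, is_kite (r (lface (inl (e, true)))) (r (lface (inl (e, false))))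
    (theta e) (K e).

(* The cone angle at the center of [f], or the boundary angle if the boundary
   of [f] contains boundary arcs. *)
Definition cone_angle (K : edge S -> kite X) (f : face S) : R :=
  \sum_(d : edge S * bool | lface (inl d) == f) center_angle (K d.1) d.2.

Definition circle_pattern_radii (theta : edge S -> R) (Phi : face S -> R)
    (r : face S -> R) : Prop :=
  (forall f, 0 < r f) /\
  exists K : edge S -> kite X,
    circle_pattern theta r K /\ forall f, cone_angle K f = Phi f.

End Patterns.
End Geometry.

Section Dilogarithm.
Variable R : realType.

Definition cexp (z : R[i]) : R[i] :=
  (expR (complex.Re z) * cos (complex.Im z))
  +i* (expR (complex.Re z) * sin (complex.Im z)).

(* The principal branches, with argument in ]-pi, pi]. *)
Definition carg (z : R[i]) : R :=
  let a := acos (complex.Re z / complex.Re `|z|) in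
  if 0 <= complex.Im z then a else - a.

Definition clog (z : R[i]) : R[i] := ln (complex.Re `|z|) +i* carg z.

(* The integral of [f] along the segment from 0 to [z]. *)
Definition segment_integral (f : R[i] -> R[i]) (z : R[i]) : R[i] :=
  (\int[lebesgue_measure]_(t in `[0%R, 1%R]) complex.Re (f (t%:C * z) * z))
  +i* (\int[lebesgue_measure]_(t in `[0%R, 1%R]) complex.Im (f (t%:C * z) * z)).

(* The complement of [1, +oo[ is star-shaped with respect to 0, so the segment
   is an admissible path there. *)
Definition Li2 (z : R[i]) : R[i] :=
  - segment_integral (fun zeta => clog (1 - zeta) / zeta) z.

End Dilogarithm.

Section Functionals.
Variables (R : realType) (S : cellular_surface).
Variables (theta : edge S -> R) (Phi : face S -> R).

Definition S_Euc (rho : face S -> R) : R :=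
  \sum_(e : edge S)
    (let rj := rho (lface (inl (e, true))) in
     let rk := rho (lface (inl (e, false))) in
     complex.Im (Li2 (cexp ((rk - rj) +i* theta e)))
     + complex.Im (Li2 (cexp ((rj - rk) +i* theta e)))
     - (pi - theta e) * (rj + rk))
  + \sum_(f : face S) Phi f * rho f.

Definition S_hyp (rho : face S -> R) : R :=
  \sum_(e : edge S)
    (let rj := rho (lface (inl (e, true))) in
     let rk := rho (lface (inl (e, false))) in
     complex.Im (Li2 (cexp ((rk - rj) +i* theta e)))
     + complex.Im (Li2 (cexp ((rj - rk) +i* theta e)))
     + complex.Im (Li2 (cexp ((rj + rk) +i* theta e)))
     + complex.Im (Li2 (cexp ((- rj - rk) +i* theta e))))
  + \sum_(f : face S) Phi f * rho f.

End Functionals.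

(* Differentiability of a function on R^I is a notion of the normed space of
   row vectors, to which the function is transported by enumerating [I]. *)
Definition critical_point (R : realType) (I : finType) (g : (I -> R) -> R)
    (x : I -> R) : Prop :=
  let gv (v : 'rV[R]_#|I|) : R := g (fun i => v 0 (enum_rank i)) in
  let xv : 'rV[R]_#|I| := \row_k x (enum_val k) in
  differentiable gv xv /\ forall h : 'rV[R]_#|I|, 'd gv xv h = 0.

Definition tanh (R : realType) (x : R) : R :=
  (expR x - expR (- x)) / (expR x + expR (- x)).

(* Main.v *)
From HB Require Import structures.
Require Import Defs.
From mathcomp Require Import all_boot all_order all_algebra all_fingroup.
From mathcomp Require Import all_classical all_reals all_analysis.
From mathcomp Require Import complex ring lra.
Set Implicit Arguments.
Unset Strict Implicit.
Unset Printing Implicit Defensive.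
Import Order.TTheory GRing.Theory Num.Theory.
Import numFieldNormedType.Exports.
Local Open Scope ring_scope.

(** Everything rests on one function.  In a Euclidean triangle with two sides
    [1] and [s] that enclose the angle [theta], let [A s] be the angle opposite
    to the side [s], that is, the argument of [1 - s * e^(- i theta)].

    Variation.  The imaginary part of [log (1 - z)] at [z = t e^(x + i theta)]
    is [- A (t e^x)], so [Im Li2 (e^(x + i theta))] is the integral of
    [A (s) / s] for [s] from 0 to [e^x], and its derivative in [x] is [A (e^x)]
    ([is_derive_Im_Li2]).  The angle sum of the triangle reads
    [A (e^x) + A (e^(- x)) = pi - theta] ([half_angle_inv]); with it the terms
    that an edge contributes to a partial derivative collapse, and the
    derivative along [rho f] is [Phi f] minus the sum of [2 phi] over the
    oriented boundary of [f], where [phi] is [A (e^(rk - rj))] for [S_Euc] and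
    [A (e^(rk - rj)) - A (e^(rk + rj))] for [S_hyp] ([gradient_S_Euc],
    [gradient_S_hyp]).

    Negativity.  As [A] is increasing, the hyperbolic [phi] is positive only if
    [rho f < 0]; since a critical point expresses [Phi f > 0] as a sum of such
    terms, all its coordinates are negative.

    Geometry.  The axis cuts a kite into two triangles of which two sides and
    the enclosed angle [theta] are prescribed.  Such a triangle exists, and its
    angle at the center is [phi]: for the Euclidean plane this is the
    definition of [A] ([euclidean_triangle_angle]), for the hyperbolic plane it
    is the law of cosines rewritten in [tanh (r / 2)]
    ([hyperbolic_triangle_angle]).  Hence kites with given radii always exist,
    their cone angles do not depend on their choice, and the vanishing of the
    gradient is the equation of the cone angles with [Phi]
    ([circle_pattern_radiiE]). *)

(** * Half the kite angle as a function of the ratio of the radii *)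

Section HalfAngle.
Variables (R : realType) (theta : R).
Hypothesis theta_range : 0 < theta < pi.

(** The argument of [1 - s * e^(- i theta)], written so that it is visibly
    smooth in [s], also at [s = 0], where the arc cosine of the law of cosines
    is not differentiable. *)
Definition half_angle (s : R) : R :=
  atan ((s - cos theta) / sin theta) + pi / 2 - theta.

(** The modulus of [1 - s * e^(- i theta)]. *)
Definition opposite_side (s : R) : R :=
  Num.sqrt (1 - 2 * s * cos theta + s ^+ 2).

Lemma sin_theta_gt0 : 0 < sin theta.
Proof. exact: sin_gt0_pi. Qed.

Lemma opposite_sideE (s : R) :
  1 - 2 * s * cos theta + s ^+ 2 = sin theta ^+ 2 + (s - cos theta) ^+ 2.
Proof. by rewrite sin2cos2; ring. Qed.

Lemma opposite_side_gt0 (s : R) : 0 < opposite_side s.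
Proof.
rewrite sqrtr_gt0 opposite_sideE.
by rewrite ltr_pwDl ?sqr_ge0 // exprn_gt0 // sin_theta_gt0.
Qed.

Lemma sqr_opposite_side (s : R) :
  opposite_side s ^+ 2 = 1 - 2 * s * cos theta + s ^+ 2.
Proof.
by rewrite sqr_sqrtr // ltW // -sqrtr_gt0; exact: opposite_side_gt0.
Qed.

Lemma cos_atan_opposite (s : R) :
  cos (atan ((s - cos theta) / sin theta)) = sin theta / opposite_side s.
Proof.
have s0 := sin_theta_gt0.
rewrite cos_atan.
have -> : 1 + ((s - cos theta) / sin theta) ^+ 2
    = (opposite_side s / sin theta) ^+ 2.
  rewrite [in RHS]expr_div_n sqr_opposite_side opposite_sideE; field.
  by rewrite gt_eqF.
by rewrite sqrtr_sqr gtr0_norm ?divr_gt0 ?opposite_side_gt0 // invf_div.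
Qed.

Lemma sin_atan_opposite (s : R) :
  sin (atan ((s - cos theta) / sin theta)) = (s - cos theta) / opposite_side s.
Proof.
set a := atan _.
have ca : cos a = sin theta / opposite_side s := cos_atan_opposite s.
have s0 := sin_theta_gt0; have D0 := opposite_side_gt0 s.
have ta : tan a = (s - cos theta) / sin theta by rewrite /a atanK.
have -> : sin a = tan a * cos a.
  by rewrite /tan divfK // ca gt_eqF // divr_gt0.
by rewrite ta ca; field; rewrite !gt_eqF.
Qed.

Lemma cos_half_angle (s : R) :
  cos (half_angle s) = (1 - s * cos theta) / opposite_side s.
Proof.
rewrite /half_angle.
have -> : forall a, a + pi / 2 - theta = pi / 2 - (theta - a) :> R.
  by move=> a; ring.
rewrite cosB cos_pihalf sin_pihalf mul0r add0r mul1r sinB.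
rewrite cos_atan_opposite sin_atan_opposite.
have D0 := opposite_side_gt0 s.
transitivity ((sin theta ^+ 2 - cos theta * (s - cos theta)) / opposite_side s).
  by field; rewrite gt_eqF.
by rewrite sin2cos2; congr (_ / _); ring.
Qed.

Lemma sin_half_angle (s : R) :
  sin (half_angle s) = s * sin theta / opposite_side s.
Proof.
rewrite /half_angle.
have -> : forall a, a + pi / 2 - theta = pi / 2 - (theta - a) :> R.
  by move=> a; ring.
rewrite sinB cos_pihalf sin_pihalf mul0r subr0 mul1r cosB.
rewrite cos_atan_opposite sin_atan_opposite.
by have D0 := opposite_side_gt0 s; field; rewrite gt_eqF.
Qed.

Lemma half_angle_increasing (s t : R) : s < t -> half_angle s < half_angle t.
Proof.
move=> st; rewrite /half_angle ltrD2r ltrD2r lt_atan //.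
by rewrite ltr_pM2r ?invr_gt0 ?sin_theta_gt0 // ltrD2r.
Qed.

Lemma ltr_half_angle (s t : R) : (half_angle s < half_angle t) = (s < t).
Proof.
case: (ltgtP s t) => [st|ts|->]; last by rewrite ltxx.
  exact: half_angle_increasing.
by apply/negbTE; rewrite -leNgt ltW // half_angle_increasing.
Qed.

Lemma half_angle_lt (s : R) : half_angle s < pi - theta.
Proof.
by have := atan_ltpi2 ((s - cos theta) / sin theta); rewrite /half_angle; lra.
Qed.

(** The angle at [0] lies strictly between [- theta] and [pi - theta], and
    its sine vanishes. *)
Lemma half_angle0 : half_angle 0 = 0.
Proof.
have /andP[t0 tpi] := theta_range.
have Dl := half_angle_lt 0.
have Dg : - theta < half_angle 0.
  have := atan_gtNpi2 ((0 - cos theta) / sin theta).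
  by rewrite /half_angle; lra.
have s0 : sin (half_angle 0) = 0 by rewrite sin_half_angle !mul0r.
case: (ltgtP (half_angle 0) 0) => // h.
- have : 0 < sin (- half_angle 0).
    by apply: sin_gt0_pi; apply/andP; split; lra.
  by rewrite sinN s0 oppr0 ltxx.
- have : 0 < sin (half_angle 0).
    by apply: sin_gt0_pi; apply/andP; split; lra.
  by rewrite s0 ltxx.
Qed.

Lemma half_angle_gt0 (s : R) : 0 < s -> 0 < half_angle s.
Proof. by rewrite -{2}half_angle0 ltr_half_angle. Qed.

Lemma half_angle_ge0 (s : R) : 0 <= s -> 0 <= half_angle s.
Proof.
by rewrite le_eqVlt => /predU1P[<-|/half_angle_gt0/ltW//]; rewrite half_angle0.
Qed.

(** The law of cosines: this is how the angle appears both in a triangle and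
    in the principal branch of the logarithm. *)
Lemma half_angle_acos (s : R) : 0 <= s ->
  half_angle s = acos ((1 - s * cos theta) / opposite_side s).
Proof.
move=> s0; have /andP[t0 tpi] := theta_range.
rewrite -cos_half_angle cosK // in_itv /= half_angle_ge0 //=.
by have := half_angle_lt s; lra.
Qed.

(** The angle sum of the triangle with sides [1] and [s]: scaling by [s^-1]
    exchanges the two sides. *)
Lemma half_angle_inv (s : R) : 0 < s ->
  half_angle s + half_angle s^-1 = pi - theta.
Proof.
move=> s0; have /andP[t0 tpi] := theta_range.
have D0 := opposite_side_gt0 s.
have : half_angle s^-1 = pi - theta - half_angle s; last by move=> ->; ring.
have si0 : 0 < s^-1 by rewrite invr_gt0.
have A0 := half_angle_gt0 s0; have B0 := half_angle_gt0 si0.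
have A1 := half_angle_lt s; have B1 := half_angle_lt s^-1.
apply: cos_inj; rewrite ?in_itv /=; try by apply/andP; split; lra.
have -> : cos (pi - theta - half_angle s)
    = sin (atan ((s - cos theta) / sin theta)).
  have -> : pi - theta - half_angle s
    = pi / 2 - atan ((s - cos theta) / sin theta).
    by rewrite /half_angle; field.
  by rewrite cosB cos_pihalf sin_pihalf mul0r add0r mul1r.
rewrite sin_atan_opposite cos_half_angle.
have -> : opposite_side s^-1 = opposite_side s / s.
  apply/eqP; rewrite -(@eqrXn2 _ 2) // ?ltW ?opposite_side_gt0 ?divr_gt0 //.
  rewrite expr_div_n !sqr_opposite_side; apply/eqP; field.
  by rewrite gt_eqF.
by field; rewrite !gt_eqF.
Qed.

Lemma is_derive_half_angle (s : R) :
  is_derive s 1 half_angle (sin theta / opposite_side s ^+ 2).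
Proof.
have S0 := sin_theta_gt0.
have lin : is_derive s (1 : R) (fun u => (u - cos theta) / sin theta)
    (sin theta)^-1.
  by apply: is_derive_eq; rewrite scaler0 add0r subr0 /GRing.scale /= mulr1.
have at_lin := is_derive1_comp (is_derive1_atan _) lin.
have -> : half_angle = (atan \o (fun u => (u - cos theta) / sin theta))
    + cst (pi / 2 - theta).
  by apply/funext => u; rewrite /half_angle /= addrA.
apply: is_derive_eq; rewrite addr0 sqr_opposite_side opposite_sideE.
by field; rewrite !gt_eqF //= ltr_pwDl ?sqr_ge0 ?exprn_gt0.
Qed.

End HalfAngle.

(** * The dilogarithm on rays *)

Section Dilog.
Variables (R : realType) (theta : R).
Hypothesis theta_range : 0 < theta < pi.
Local Notation mu := (@lebesgue_measure R).

(** The value at [0] is the derivative of [half_angle theta] there, which makes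
    the kernel continuous. *)
Definition dilog_kernel (s : R) : R :=
  if s == 0 then sin theta else half_angle theta s / s.

Lemma continuous_dilog_kernel (s : R) : {for s, continuous dilog_kernel}.
Proof.
have [->|s0] := eqVneq s 0; last first.
  have ev : {near s, (fun u => half_angle theta u / u) =1 dilog_kernel}.
    near=> u; rewrite /dilog_kernel ifF //; apply/negbTE.
    by near: u; exact: (cvgr_neq0 s).
  have ks : dilog_kernel s = half_angle theta s / s.
    by rewrite /dilog_kernel (negbTE s0).
  suff : (half_angle theta u / u @[u --> s] --> half_angle theta s / s)%classic.
    by rewrite -ks; apply: cvg_trans; exact: near_eq_cvg ev.
  have cA : {for s, continuous (half_angle theta)}.
    apply/differentiable_continuous/derivable1_diffP.
    by have [] := is_derive_half_angle theta_range s.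
  by apply: cvgM => //; exact: cvgV.
(* At [0] the kernel is the difference quotient of [half_angle theta]. *)
apply/continuous_withinNx.
have [dA] := is_derive_half_angle theta_range 0.
move: dA; rewrite /derivable /derive => /[swap] -> dA.
rewrite {2}/dilog_kernel eqxx.
have -> : sin theta = sin theta / opposite_side theta 0 ^+ 2.
  by rewrite sqr_opposite_side //; field.
apply: cvg_trans dA; apply: near_eq_cvg; near=> h.
have h0 : h != 0 by near: h; exact: nbhs_dnbhs_neq.
rewrite /dilog_kernel (negbTE h0) /= half_angle0 // subr0 addr0 scaler1.
by rewrite /GRing.scale /= mulrC.
Unshelve. all: by end_near.
Qed.

(** The imaginary part of [1 - t z] is negative, so the principal argument is
    minus the arc cosine of [half_angle_acos]. *)
Lemma Im_log_kernel (x t : R) : 0 < t ->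
  let z := cexp (x +i* theta)%C in
  complex.Im (clog (1 - (t%:C)%C * z) / ((t%:C)%C * z) * z)
  = - (dilog_kernel (t * expR x) * expR x).
Proof.
move=> t0 z; have x0 := expR_gt0 x.
have S0 := sin_theta_gt0 theta_range.
have z0 : z != 0.
  rewrite /z /cexp eq_complex /= negb_and; apply/orP; right.
  by rewrite mulf_neq0 // gt_eqF.
set w := clog _.
have -> : w / ((t%:C)%C * z) * z = w * ((t^-1)%:C)%C.
  by rewrite invfM mulrA divfK // fmorphV.
rewrite {}/w.
have -> : 1 - (t%:C)%C * z = ((1 - t * expR x * cos theta)
    +i* (- (t * expR x * sin theta)))%C.
  apply/eqP; rewrite /z /cexp eq_complex /=.
  by apply/andP; split; apply/eqP; ring.
have sgt0 : 0 < t * expR x by rewrite mulr_gt0.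
rewrite /clog /= mulr0 add0r /carg /= oppr_ge0 leNgt mulr_gt0 //=.
rewrite sqrrN.
have -> : (1 - t * expR x * cos theta) ^+ 2 + (t * expR x * sin theta) ^+ 2
   = 1 - 2 * (t * expR x) * cos theta + (t * expR x) ^+ 2.
  by rewrite [in X in _ + X]exprMn sin2cos2; ring.
rewrite -/(opposite_side theta _) -half_angle_acos ?ltW //.
rewrite /dilog_kernel gt_eqF //; field.
by rewrite !gt_eqF.
Qed.

(** The lower bound is negative so that [0] is an interior point and the
    primitive is differentiable there from both sides. *)
Definition dilog_primitive (c : R) : R :=
  \int[mu]_(s in `[-1, c]%classic) dilog_kernel s.

Lemma dilog_kernel_integrable (a b : R) :
  mu.-integrable `[a, b]%classic (EFin \o dilog_kernel).
Proof.
apply: continuous_compact_integrable; first exact: segment_compact.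
by apply: continuous_subspaceT => s; exact: continuous_dilog_kernel.
Qed.

Lemma is_derive_dilog_primitive (c : R) : 0 <= c ->
  is_derive c 1 dilog_primitive (dilog_kernel c).
Proof.
move=> c0.
have c1 : c < c + 1 by rewrite ltrDl.
have [] := @continuous_FTC1_closed R dilog_kernel (-1) c _ c1
  (dilog_kernel_integrable _ _) (lt_le_trans (ltrN10 _) c0)
  (@continuous_dilog_kernel c).
rewrite -/dilog_primitive derive1E => d1 d2.
exact: DeriveDef d1 d2.
Qed.

(** The substitution [s = t e^x], done through the primitive: the integrand of
    the dilogarithm is the derivative of [- dilog_primitive (t e^x)] in [t].
    The value of that integrand at [t = 0] is a junk value, hence the passage
    through the half-open interval. *)
Lemma Im_Li2E (x : R) :
  complex.Im (Li2 (cexp (x +i* theta)%C))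
  = dilog_primitive (expR x) - dilog_primitive 0.
Proof.
have x0 := expR_gt0 x.
pose g (t : R) := - (dilog_kernel (t * expR x) * expR x).
have cg : continuous g.
  move=> t; apply: cvgN; apply: cvgM; last exact: cvg_cst.
  have cl : {for t, continuous (fun u : R => u * expR x)}.
    by apply: cvgM; [exact: cvg_id|exact: cvg_cst].
  exact: (continuous_comp cl (@continuous_dilog_kernel _)).
have ig : mu.-integrable `]0, 1]%classic (EFin \o g).
  apply: (@integrableS _ _ _ mu `[0, 1]%classic `]0, 1]%classic) => //.
    by apply: subset_itvr; rewrite bnd_simp.
  apply: continuous_compact_integrable; first exact: segment_compact.
  exact: continuous_subspaceT.
pose z := cexp (x +i* theta)%C.
pose f (t : R) := complex.Im (clog (1 - (t%:C)%C * z) / ((t%:C)%C * z) * z).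
have -> : complex.Im (Li2 z) = - \int[mu]_(t in `[0, 1]%classic) f t by [].
have fg : {in `]0, 1]%classic, g =1 f}.
  move=> t; rewrite inE /= in_itv /= => /andP[t0 _].
  by rewrite [RHS]Im_log_kernel.
have intf : mu.-integrable `]0, 1]%classic (EFin \o f).
  by apply: eq_integrable ig => // t tin /=; congr EFin; exact: fg.
rewrite -(Rintegral_itv_obnd_cbnd intf) -(eq_Rintegral mu fg).
rewrite (Rintegral_itv_obnd_cbnd ig).
pose G (t : R) := - dilog_primitive (t * expR x).
have dG (t : R) : 0 <= t -> is_derive t 1 G (g t).
  move=> t0; have tx0 : 0 <= t * expR x by rewrite mulr_ge0 // ltW.
  have dlin : is_derive t (1 : R) (fun t => t * expR x) (expR x).
    by apply: is_derive_eq; rewrite scaler0 add0r /GRing.scale /= mulr1.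
  have dcomp := @is_derive1_comp _ _ (fun u => u * expR x) _ _ _
    (is_derive_dilog_primitive tx0) dlin.
  exact: is_deriveN.
have cG (t : R) : 0 <= t -> {for t, continuous G}.
  move=> /dG[d _]; exact/differentiable_continuous/derivable1_diffP.
rewrite /Rintegral (@continuous_FTC2 _ g G) //.
- by rewrite /G mul1r mul0r /=; ring.
- exact: continuous_subspaceT.
- split.
  + by move=> t; rewrite in_itv /= => /andP[/ltW/dG[]].
  + by apply: cvg_at_right_filter; exact: cG.
  + by apply: cvg_at_left_filter; exact: cG.
- by move=> t; rewrite in_itv /= => /andP[/ltW/dG[_ <-] _]; rewrite derive1E.
Qed.

Lemma is_derive_Im_Li2 (x : R) :
  is_derive x 1 (fun x => complex.Im (Li2 (cexp (x +i* theta)%C)))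
    (half_angle theta (expR x)).
Proof.
have x0 := expR_gt0 x.
have -> : (fun x => complex.Im (Li2 (cexp (x +i* theta)%C)))
    = (dilog_primitive \o expR) - cst (dilog_primitive 0).
  by apply/funext => y; rewrite Im_Li2E.
have dcomp := is_derive1_comp (is_derive_dilog_primitive (ltW x0))
  (is_derive_expR x).
by apply: is_derive_eq; rewrite subr0 /dilog_kernel gt_eqF // divfK // gt_eqF.
Qed.

End Dilog.

(** * Gradients on a finite power of the reals *)

Section Gradient.
Variables (R : realType) (I : finType).
Implicit Types (g : (I -> R) -> R) (x G : I -> R).

(** Differentiability is transported to row vectors in the same way as in
    [critical_point]. *)
Definition has_gradient g x G : Prop :=
  is_diff (\row_k x (enum_val k) : 'rV[R]_#|I|)
    (fun v : 'rV[R]_#|I| => g (fun i => v 0 (enum_rank i)))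
    (fun h => \sum_i h 0 (enum_rank i) * G i).

Lemma has_gradient_eq g g' x G G' : has_gradient g x G ->
  g =1 g' -> G =1 G' -> has_gradient g' x G'.
Proof. by move=> + /funext <- /funext <-. Qed.

Lemma has_gradient_coord x i :
  has_gradient (fun y => y i) x (fun j => (i == j)%:R).
Proof.
have lin : linear (fun v : 'rV[R]_#|I| => v 0 (enum_rank i) : R^o).
  by move=> a u v; rewrite !mxE.
pose linM := GRing.isLinear.Build _ _ _ _ _ lin.
pose linL : {linear _ -> _} := HB.pack
  (fun v : 'rV[R]_#|I| => v 0 (enum_rank i)) linM.
have cL : continuous linL by exact: coord_continuous.
apply: DiffDef; first exact: (linear_differentiable _ cL).
rewrite (diff_lin _ cL).
apply/funext => h /=; rewrite (bigD1 i) //= eqxx mulr1 big1 ?addr0 //.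
by move=> j /negbTE; rewrite eq_sym => ->; rewrite mulr0.
Qed.

Lemma has_gradientD g1 g2 x G1 G2 :
  has_gradient g1 x G1 -> has_gradient g2 x G2 ->
  has_gradient (fun y => g1 y + g2 y) x (fun i => G1 i + G2 i).
Proof.
move=> d1 d2; apply: is_diff_eq (is_diffD d1 d2) _.
apply/funext => h; rewrite addrfctE -big_split /=.
by apply: eq_bigr => i _; rewrite mulrDr.
Qed.

Lemma has_gradientZ c g x G :
  has_gradient g x G -> has_gradient (fun y => c * g y) x (fun i => c * G i).
Proof.
move=> d; apply: is_diff_eq (is_diffZ c d) _.
apply/funext => h; rewrite scalrfctE /GRing.scale /= mulr_sumr.
by apply: eq_bigr => i _; rewrite mulrCA.
Qed.

Lemma has_gradientB g1 g2 x G1 G2 :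
  has_gradient g1 x G1 -> has_gradient g2 x G2 ->
  has_gradient (fun y => g1 y - g2 y) x (fun i => G1 i - G2 i).
Proof.
move=> d1 /(has_gradientZ (-1)) d2.
apply: has_gradient_eq (has_gradientD d1 d2) _ _.
  by move=> y; rewrite mulN1r.
by move=> i; rewrite mulN1r.
Qed.

Lemma has_gradient_sum (J : Type) (r : seq J) (g : J -> (I -> R) -> R) x
    (G : J -> I -> R) :
  (forall j, has_gradient (g j) x (G j)) ->
  has_gradient (fun y => \sum_(j <- r) g j y) x (fun i => \sum_(j <- r) G j i).
Proof.
move=> d; elim: r => [|j r IH].
  have d0 : has_gradient (fun=> 0) x (fun=> 0).
    apply: is_diff_eq; first exact: (is_diff_cst 0).
    by apply/funext => h /=; rewrite big1 // => i _; rewrite mulr0.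
  by apply: has_gradient_eq d0 _ _ => ?; rewrite big_nil.
by apply: has_gradient_eq (has_gradientD (d j) IH) _ _ => ?; rewrite big_cons.
Qed.

Lemma has_gradient_comp (phi : R -> R) (dphi : R) g x G :
  is_derive (g x) 1 phi dphi -> has_gradient g x G ->
  has_gradient (fun y => phi (g y)) x (fun i => dphi * G i).
Proof.
move=> [dp dphiE] dg.
have gxE : g x
    = g (fun i => (\row_k x (enum_val k) : 'rV[R]_#|I|) 0 (enum_rank i)).
  by congr g; apply/funext => i; rewrite mxE enum_rankK.
have dphi_diff : is_diff (g x) phi (fun u => u * dphi).
  apply: DiffDef; first exact/derivable1_diffP.
  by rewrite deriv1E // derive1E dphiE.
rewrite gxE in dphi_diff.
apply: is_diff_eq (is_diff_comp dg dphi_diff) _.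
apply/funext => h; rewrite /= mulr_suml; apply: eq_bigr => i _.
by rewrite -mulrA [G i * _]mulrC.
Qed.

Lemma critical_point_gradient g x G : has_gradient g x G ->
  critical_point g x <-> forall i, G i = 0.
Proof.
move=> dg; split.
  move=> [_ crit] i; have := crit (\row_k (enum_val k == i)%:R).
  have /= -> := @diff_val _ _ _ _ _ _ _ dg.
  rewrite (bigD1 i) //= big1 ?addr0 => [|j ji].
    by rewrite !mxE enum_rankK eqxx mul1r.
  by rewrite !mxE enum_rankK (negbTE ji) mul0r.
move=> G0; split; first by have [] := dg.
move=> h; have /= -> := @diff_val _ _ _ _ _ _ _ dg.
by rewrite big1 // => i _; rewrite G0 mulr0.
Qed.

End Gradient.

(** * The partial derivatives of the functionals *)

Section Functionals.
Variables (R : realType) (S : cellular_surface).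
Variables (theta : edge S -> R) (Phi : face S -> R).
Hypothesis theta_range : forall e, 0 < theta e < pi.

Definition opposite_face (d : edge S * bool) : face S :=
  lface (inl (d.1, ~~ d.2)).

Definition euclidean_half_angle (theta rj rk : R) : R :=
  half_angle theta (expR (rk - rj)).

Definition hyperbolic_half_angle (theta rj rk : R) : R :=
  half_angle theta (expR (rk - rj)) - half_angle theta (expR (rk + rj)).

(** An edge with [f] on both sides has both orientations in the boundary of
    [f], so the two indicators on the left are added, not disjoined. *)
Lemma sum_oriented_boundary (a : edge S * bool -> R) (f : face S) :
  \sum_(e : edge S) ((lface (inl (e, true)) == f)%:R * a (e, true)
     + (lface (inl (e, false)) == f)%:R * a (e, false))
  = \sum_(d : edge S * bool | lface (inl d) == f) a d.
Proof.
transitivity (\sum_(e : edge S) \sum_(b : bool)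
    (if lface (inl (e, b)) == f then a (e, b) else 0)).
  by apply: eq_bigr => e _; rewrite big_bool /=; do 2 case: eqP => _;
     rewrite ?mul1r ?mul0r.
by rewrite pair_bigA [in RHS]big_mkcond; apply: eq_bigr => -[].
Qed.

Lemma gradient_linear (rho : face S -> R) :
  has_gradient (fun y => \sum_(f : face S) Phi f * y f) rho Phi.
Proof.
apply: has_gradient_eq.
- exact: (has_gradient_sum (index_enum (face S))
    (fun f => has_gradientZ (Phi f) (has_gradient_coord rho f))).
- by [].
- move=> f /=; rewrite (bigD1 f) //= eqxx mulr1 big1 ?addr0 //.
  by move=> j /negbTE ->; rewrite mulr0.
Qed.

Lemma gradient_Li2 e (g : (face S -> R) -> R) (rho G : face S -> R) :
  has_gradient g rho G ->
  has_gradient (fun y => complex.Im (Li2 (cexp (g y +i* theta e)%C))) rho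
    (fun f => half_angle (theta e) (expR (g rho)) * G f).
Proof.
exact: (has_gradient_comp (is_derive_Im_Li2 (theta_range e) (g rho))).
Qed.

Lemma half_angle_expN e (x : R) :
  half_angle (theta e) (expR (- x)) =
  pi - theta e - half_angle (theta e) (expR x).
Proof.
rewrite expRN -(half_angle_inv (theta_range e) (expR_gt0 x)).
by rewrite addrAC subrr add0r.
Qed.

(** Both functionals are a sum over edges plus the same linear part, so only
    the contribution of a single edge has to be computed for each of them. *)
Lemma gradient_functional (T : edge S -> (face S -> R) -> R)
    (a : edge S * bool -> R) (rho : face S -> R) :
  (forall e, has_gradient (T e) rho (fun f =>
    - ((lface (inl (e, true)) == f)%:R * a (e, true)
       + (lface (inl (e, false)) == f)%:R * a (e, false)))) ->
  has_gradient
    (fun y => \sum_(e : edge S) T e y + \sum_(f : face S) Phi f * y f) rho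
     (fun f => Phi f - \sum_(d | lface (inl d) == f) a d).
Proof.
move=> dT; apply: has_gradient_eq.
- exact: (has_gradientD (has_gradient_sum (index_enum (edge S)) dT)
    (gradient_linear rho)).
- by [].
- by move=> f /=; rewrite addrC sumrN sum_oriented_boundary.
Qed.

(** The two dilogarithms contribute [A (e^(rj - rk)) - A (e^(rk - rj))] to the
    derivative along [rj], the linear term [- (pi - theta)]; by
    [half_angle_expN] this is [- 2 A (e^(rk - rj))]. *)
Lemma gradient_S_Euc (rho : face S -> R) :
  has_gradient (S_Euc theta Phi) rho (fun f => Phi f -
    \sum_(d : edge S * bool | lface (inl d) == f)
      2 * euclidean_half_angle (theta d.1) (rho (lface (inl d)))
        (rho (opposite_face d))).
Proof.
apply: (@gradient_functional (fun e y =>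
    let rj := y (lface (inl (e, true))) in
    let rk := y (lface (inl (e, false))) in
    complex.Im (Li2 (cexp ((rk - rj) +i* theta e)%C))
    + complex.Im (Li2 (cexp ((rj - rk) +i* theta e)%C))
    - (pi - theta e) * (rj + rk))
  (fun d => 2 * euclidean_half_angle (theta d.1)
    (rho (lface (inl d))) (rho (opposite_face d)))) => e.
have dj := has_gradient_coord rho (lface (inl (e, true))).
have dk := has_gradient_coord rho (lface (inl (e, false))).
have dL := gradient_Li2 e (has_gradientB dk dj).
have dL' := gradient_Li2 e (has_gradientB dj dk).
have dlin := has_gradientZ (pi - theta e) (has_gradientD dj dk).
apply: has_gradient_eq (has_gradientB (has_gradientD dL dL') dlin) _ _ => //.
move=> f; rewrite /euclidean_half_angle /opposite_face /=.
set j := lface (inl (e, true)); set k := lface (inl (e, false)).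
rewrite -[rho j - rho k]opprB (half_angle_expN e (rho k - rho j)).
move: (half_angle _ _) (_ == f) (_ == f) => A dj_f dk_f; ring.
Qed.

(** The derivative along [rj] of the four dilogarithms is
    [A (e^(rj - rk)) - A (e^(rk - rj)) + A (e^(rj + rk)) - A (e^(- rj - rk))];
    the two supplements [pi - theta] produced by [half_angle_expN] cancel. *)
Lemma gradient_S_hyp (rho : face S -> R) :
  has_gradient (S_hyp theta Phi) rho (fun f => Phi f -
    \sum_(d : edge S * bool | lface (inl d) == f)
      2 * hyperbolic_half_angle (theta d.1) (rho (lface (inl d)))
        (rho (opposite_face d))).
Proof.
apply: (@gradient_functional (fun e y =>
    let rj := y (lface (inl (e, true))) in
    let rk := y (lface (inl (e, false))) in
    complex.Im (Li2 (cexp ((rk - rj) +i* theta e)%C))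
    + complex.Im (Li2 (cexp ((rj - rk) +i* theta e)%C))
    + complex.Im (Li2 (cexp ((rj + rk) +i* theta e)%C))
    + complex.Im (Li2 (cexp ((- rj - rk) +i* theta e)%C)))
  (fun d => 2 * hyperbolic_half_angle (theta d.1)
    (rho (lface (inl d))) (rho (opposite_face d)))) => e.
have dj := has_gradient_coord rho (lface (inl (e, true))).
have dk := has_gradient_coord rho (lface (inl (e, false))).
have dL1 := gradient_Li2 e (has_gradientB dk dj).
have dL2 := gradient_Li2 e (has_gradientB dj dk).
have dL3 := gradient_Li2 e (has_gradientD dj dk).
have dL4 := gradient_Li2 e (has_gradientB (has_gradientZ (-1) dj) dk).
apply: has_gradient_eq
  (has_gradientD (has_gradientD (has_gradientD dL1 dL2) dL3) dL4) _ _.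
  by move=> y; rewrite mulN1r.
move=> f; rewrite /hyperbolic_half_angle /opposite_face /= mulN1r -opprD.
set j := lface (inl (e, true)); set k := lface (inl (e, false)).
rewrite -[rho j - rho k]opprB (half_angle_expN e (rho k - rho j)).
rewrite (half_angle_expN e (rho j + rho k)) [rho k + rho j]addrC.
move: (half_angle _ _) (half_angle _ _) (_ == f) (_ == f) => A B dj_f dk_f.
ring.
Qed.

End Functionals.

(** * Patterns and the angles of triangles *)

Section PatternAngles.
Variables (R : realType) (X : plane R) (S : cellular_surface).
Variable phi : R -> R -> R -> R.
Hypothesis dist_sym : forall p q : X, dist p q = dist q p.
Hypothesis angle_sym : forall p q s : X, angle p q s = angle s q p.
Hypothesis triangle_angle : forall (p q s : X) (theta rl rr : R),
  0 < theta < pi -> 0 < rl -> 0 < rr ->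
  dist p q = rl -> dist q s = rr -> angle p q s = theta ->
  angle q p s = phi theta rl rr.
Hypothesis kite_exists : forall theta rl rr : R,
  0 < theta < pi -> 0 < rl -> 0 < rr ->
  exists K : kite X, is_kite rl rr theta K.
Variables (theta : edge S -> R) (Phi r : face S -> R).
Hypothesis theta_range : forall e, 0 < theta e < pi.

(** The four vertex angles at the ends of the axis belong to the two triangles,
    which are mirror images of each other. *)
Lemma center_angleE (th rl rr : R) (K : kite X) (b : bool) :
  0 < th < pi -> 0 < rl -> 0 < rr -> is_kite rl rr th K ->
  center_angle K b = 2 * (if b then phi th rl rr else phi th rr rl).
Proof.
move=> th0 rl0 rr0 [[d1 d2 d3 d4] a1 a2 _ _].
have a1' := a1; have a2' := a2; have d1' := d1; have d2' := d2.
have d3' := d3; have d4' := d4.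
rewrite angle_sym in a1'; rewrite angle_sym in a2'.
rewrite dist_sym in d1'; rewrite dist_sym in d2'.
rewrite dist_sym in d3'; rewrite dist_sym in d4'.
case: b; rewrite /center_angle mulr_natl mulr2n; congr (_ + _).
- exact: triangle_angle d1 d2 a1.
- by rewrite angle_sym; exact: triangle_angle d4' d3' a2'.
- exact: triangle_angle d3 d4 a2.
- by rewrite angle_sym; exact: triangle_angle d2' d1' a1'.
Qed.

(** Common to both geometries: once two sides and the enclosed angle of a
    triangle determine its angle [phi] at the center, and kites exist, radii
    belong to a pattern exactly if the [phi] sum up to the cone angles. *)
Lemma circle_pattern_radiiE :
  circle_pattern_radii X theta Phi r <->
  (forall f, 0 < r f) /\
  forall f, \sum_(d : edge S * bool | lface (inl d) == f)
    2 * phi (theta d.1) (r (lface (inl d))) (r (opposite_face d)) = Phi f.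
Proof.
have cone (K : edge S -> kite X) : (forall f, 0 < r f) ->
    circle_pattern theta r K -> forall f, cone_angle K f =
    \sum_(d : edge S * bool | lface (inl d) == f)
      2 * phi (theta d.1) (r (lface (inl d))) (r (opposite_face d)).
  move=> r0 cp f; apply: eq_bigr => -[e b] _.
  by rewrite (center_angleE _ _ _ _ (cp e)) //; case: b.
split=> [[r0 [K [cp cK]]]|[r0 rE]]; split=> //.
  by move=> f; rewrite -(cone K).
have [K cp] := choice (fun e => kite_exists (theta_range e)
  (r0 (lface (inl (e, true)))) (r0 (lface (inl (e, false))))).
by exists K; split => // f; rewrite cone.
Qed.

End PatternAngles.

(** * Euclidean triangles and kites *)

Section EuclideanTriangle.
Variable R : realType.
Implicit Types (u v : 'rV[R]_2) (theta rl rr : R).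

Lemma sqrtr_eq (x r : R) : 0 <= r -> x = r ^+ 2 -> Num.sqrt x = r.
Proof. by move=> r0 ->; rewrite sqrtr_sqr ger0_norm. Qed.

Lemma dot2E u v : dot u v = u 0 0 * v 0 0 + u 0 1 * v 0 1.
Proof.
rewrite /dot !big_ord_recl big_ord0 addr0.
by congr (_ + u _ _ * v _ _); apply/val_inj.
Qed.

(** The Cauchy-Schwarz inequality, from Lagrange's identity, ensures that the
    argument of the arc cosine is in its domain. *)
Lemma cos_vangle_dot u v (a b : R) : 0 < a -> 0 < b ->
  dot u u = a ^+ 2 -> dot v v = b ^+ 2 ->
  dot u v = a * b * cos (vangle (@dot R 2) u v).
Proof.
move=> a0 b0 uu vv.
have ab0 : 0 < a * b by rewrite mulr_gt0.
rewrite /vangle (sqrtr_eq (ltW a0) uu) (sqrtr_eq (ltW b0) vv).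
rewrite acosK; first by rewrite mulrC divfK // gt_eqF.
have cs : (dot u v / (a * b)) ^+ 2 <= 1.
  rewrite expr_div_n ler_pdivrMr ?exprn_gt0 // mul1r exprMn -uu -vv !dot2E.
  by have := sqr_ge0 (u 0 0 * v 0 1 - u 0 1 * v 0 0); nra.
by rewrite in_itv /= -ler_norml -(@expr_le1 _ 2) // -normrX ger0_norm ?sqr_ge0.
Qed.

Lemma euclidean_triangle_angle (p q s : euclidean_plane R) theta rl rr :
  0 < theta < pi -> 0 < rl -> 0 < rr ->
  dist p q = rl -> dist q s = rr -> angle p q s = theta ->
  angle q p s = half_angle theta (rr / rl).
Proof.
move=> th0 rl0 rr0 /= dl dr at_q.
have sqrt_dot (w : 'rV[R]_2) r : 0 < r -> Num.sqrt (dot w w) = r ->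
    dot w w = r ^+ 2.
  move=> r0 <-; rewrite sqr_sqrtr // dot2E -!expr2 addr_ge0 ?sqr_ge0 //.
have pp := sqrt_dot _ _ rl0 dl; have ss := sqrt_dot _ _ rr0 dr.
have qq : dot (p - q) (p - q) = rl ^+ 2 by rewrite -pp !dot2E !mxE; ring.
have := cos_vangle_dot rl0 rr0 qq ss; rewrite at_q => pqs.
rewrite half_angle_acos ?divr_ge0 ?ltW // /vangle; congr acos.
have D0 := opposite_side_gt0 th0 (rr / rl).
have DE := sqr_opposite_side th0 (rr / rl).
have sp : dot (s - p) (s - p) = (rl * opposite_side theta (rr / rl)) ^+ 2.
  have -> : dot (s - p) (s - p) = rl ^+ 2 + rr ^+ 2 - 2 * dot (p - q) (s - q).
    by rewrite -qq -ss !dot2E !mxE; ring.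
  by rewrite pqs exprMn DE; field; rewrite gt_eqF.
have num : dot (q - p) (s - p) = rl ^+ 2 - rl * rr * cos theta.
  by rewrite -pqs -qq !dot2E !mxE; ring.
rewrite (sqrtr_eq _ pp) ?ltW // (sqrtr_eq _ sp) ?mulr_ge0 ?ltW // num.
by field; rewrite !gt_eqF.
Qed.

Definition vec2 (x y : R) : 'rV[R]_2 := \row_j (if j == 0 then x else y).

(** The axis is put on the first coordinate axis, starting at the origin; the
    remaining two vertices have the coordinates [(x, - y)] and [(x, y)] that
    the law of cosines dictates. *)
Lemma euclidean_kite_exists theta rl rr :
  0 < theta < pi -> 0 < rl -> 0 < rr ->
  exists K : kite (euclidean_plane R), is_kite rl rr theta K.
Proof.
move=> th0 rl0 rr0; have S0 := sin_theta_gt0 th0.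
have SE := sin2cos2 theta.
have l2_gt0 : 0 < rl ^+ 2 + rr ^+ 2 - 2 * rl * rr * cos theta.
  have -> : rl ^+ 2 + rr ^+ 2 - 2 * rl * rr * cos theta
      = (rl - rr * cos theta) ^+ 2 + (rr * sin theta) ^+ 2.
    by rewrite [X in _ = _ + X]exprMn SE; ring.
  by rewrite ltr_wpDl ?sqr_ge0 // exprn_gt0 // mulr_gt0.
pose l := Num.sqrt (rl ^+ 2 + rr ^+ 2 - 2 * rl * rr * cos theta).
have l0 : 0 < l by rewrite sqrtr_gt0.
have lE : l ^+ 2 = rl ^+ 2 + rr ^+ 2 - 2 * rl * rr * cos theta.
  by rewrite sqr_sqrtr // ltW.
pose x := (rl ^+ 2 - rl * rr * cos theta) / l.
pose y := rl * rr * sin theta / l.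
have y0 : 0 < y by rewrite divr_gt0 // !mulr_gt0.
have xl : x * l = rl ^+ 2 - rl * rr * cos theta by rewrite divfK // gt_eqF.
have yl : y * l = rl * rr * sin theta by rewrite divfK // gt_eqF.
have xy : x ^+ 2 + y ^+ 2 = rl ^+ 2.
  apply: (@mulIf _ (l ^+ 2)); first by rewrite expf_neq0 // gt_eqF.
  transitivity ((x * l) ^+ 2 + (y * l) ^+ 2); first by ring.
  by rewrite xl yl lE [X in _ + X]exprMn SE; ring.
have lxy : (l - x) ^+ 2 + y ^+ 2 = rr ^+ 2.
  transitivity (l ^+ 2 - 2 * (x * l) + (x ^+ 2 + y ^+ 2)); first by ring.
  by rewrite lE xl xy; ring.
have xlxy : x * (x - l) + y ^+ 2 = rl * rr * cos theta.
  transitivity (x ^+ 2 + y ^+ 2 - x * l); first by ring.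
  by rewrite xl xy; ring.
have acos_theta (b : R) : b = rl * rr -> acos (rl * rr * cos theta / b) = theta.
  move=> ->; rewrite mulrC mulrA mulVf ?mul1r; last by rewrite gt_eqF ?mulr_gt0.
  by rewrite cosK // in_itv /=; case/andP: th0 => /ltW -> /ltW ->.
exists (@Kite _ (euclidean_plane R)
  (vec2 0 0) (vec2 x (- y)) (vec2 l 0) (vec2 x y)).
rewrite /is_kite /= /vangle !dot2E !mxE /= !subr0 !sub0r.
split; first split.
- by apply: sqrtr_eq (ltW _) _ => //; rewrite -xy; ring.
- by apply: sqrtr_eq (ltW _) _ => //; rewrite -lxy; ring.
- by apply: sqrtr_eq (ltW _) _ => //; rewrite -lxy; ring.
- by apply: sqrtr_eq (ltW _) _ => //; rewrite -xy; ring.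
- have -> : - x * (l - x) + - - y * - - y = rl * rr * cos theta.
    by rewrite -xlxy; ring.
  apply: acos_theta; congr (_ * _).
    by apply: sqrtr_eq (ltW _) _ => //; rewrite -xy; ring.
  by apply: sqrtr_eq (ltW _) _ => //; rewrite -lxy; ring.
- have -> : (l - x) * - x + - y * - y = rl * rr * cos theta.
    by rewrite -xlxy; ring.
  apply: acos_theta; rewrite mulrC; congr (_ * _).
    by apply: sqrtr_eq (ltW _) _ => //; rewrite -xy; ring.
  by apply: sqrtr_eq (ltW _) _ => //; rewrite -lxy; ring.
- by rewrite mulr0 sub0r mulNr opprK mulr_gt0.
- by rewrite mulr0 sub0r mulrN opprK mulr_gt0.
Qed.

Lemma dist_euclidean_sym (p q : euclidean_plane R) : dist p q = dist q p.
Proof. by rewrite /= !dot2E !mxE; congr Num.sqrt; ring. Qed.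

Lemma vangle_dot_sym u v : vangle (@dot R 2) u v = vangle (@dot R 2) v u.
Proof.
rewrite /vangle [_ * Num.sqrt _]mulrC; congr (acos (_ / _)).
by rewrite !dot2E; ring.
Qed.

Lemma angle_euclidean_sym (p q s : euclidean_plane R) :
  angle p q s = angle s q p.
Proof. exact: vangle_dot_sym. Qed.

Lemma euclidean_circle_pattern_radiiE (S : cellular_surface)
    (theta : edge S -> R) (Phi r : face S -> R) :
  (forall e, 0 < theta e < pi) -> (forall f, 0 < r f) ->
  circle_pattern_radii (euclidean_plane R) theta Phi r <->
  forall f, \sum_(d : edge S * bool | lface (inl d) == f)
    2 * half_angle (theta d.1) (r (opposite_face d) / r (lface (inl d)))
  = Phi f.
Proof.
move=> th0 r0.
rewrite (circle_pattern_radiiE dist_euclidean_sym angle_euclidean_sym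
  euclidean_triangle_angle euclidean_kite_exists Phi r th0).
by split=> [[]|].
Qed.

End EuclideanTriangle.

(** * Hyperbolic trigonometry in the hyperboloid model *)

Section HyperbolicTriangle.
Variable R : realType.
Implicit Types (u v w : 'rV[R]_3) (p q s : hyperboloid R) (theta r rl rr : R).

Definition cosh r : R := (expR r + expR (- r)) / 2.
Definition sinh r : R := (expR r - expR (- r)) / 2.

Lemma cosh2 r : cosh r ^+ 2 = 1 + sinh r ^+ 2.
Proof.
have E0 : expR r != 0 by rewrite gt_eqF // expR_gt0.
by rewrite /cosh /sinh expRN; field.
Qed.

Lemma sinh_gt0 r : 0 < r -> 0 < sinh r.
Proof. by move=> r0; rewrite divr_gt0 // subr_gt0 ltr_expR; lra. Qed.

Lemma cosh_gt0 r : 0 < cosh r.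
Proof. by rewrite divr_gt0 // addr_gt0 ?expR_gt0. Qed.

(** The rational parametrization of the hyperbola. *)
Lemma tanh_half r : 0 < r -> let t := tanh (r / 2) in
  [/\ 0 < t < 1, cosh r = (1 + t ^+ 2) / (1 - t ^+ 2)
    & sinh r = 2 * t / (1 - t ^+ 2)].
Proof.
move=> r0 t.
set E := expR (r / 2).
have E1 : 1 < E by rewrite /E expR_gt1 divr_gt0.
have E0 : 0 < E by rewrite expR_gt0.
have rE : expR r = E ^+ 2.
  by rewrite expr2 -expRD; congr expR; field.
have tE : t = (E ^+ 2 - 1) / (E ^+ 2 + 1).
  rewrite /t /tanh expRN -/E; field.
  by rewrite !gt_eqF //= ?addr_gt0 ?exprn_gt0 ?invr_gt0.
have Ep : 0 < E ^+ 2 + 1 by rewrite addr_gt0 ?exprn_gt0.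
have Em : 0 < E ^+ 2 - 1 by rewrite subr_gt0 exprn_egt1.
have t2 : 1 - t ^+ 2 = 4 * E ^+ 2 / (E ^+ 2 + 1) ^+ 2.
  by rewrite tE; field; rewrite gt_eqF.
rewrite t2 tE; split.
- by rewrite divr_gt0 //= ltr_pdivrMr // mul1r; lra.
- by rewrite /cosh expRN rE; field; rewrite !gt_eqF.
- by rewrite /sinh expRN rE; field; rewrite !gt_eqF.
Qed.

Lemma arcosh_cosh r : 0 < r -> arcosh (cosh r) = r.
Proof.
move=> r0; rewrite /arcosh.
rewrite (@sqrtr_eq _ _ (sinh r)) ?ltW ?sinh_gt0 //; last first.
  by rewrite cosh2 addrC addKr.
have -> : cosh r + sinh r = expR r by rewrite /cosh /sinh; field.
exact: expRK.
Qed.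

Lemma cosh_arcosh (x : R) : 1 <= x -> cosh (arcosh x) = x.
Proof.
move=> x1; have x20 : 0 <= x ^+ 2 - 1 by rewrite subr_ge0 exprn_ege1.
rewrite /cosh /arcosh.
set y := Num.sqrt _; have y2 : y ^+ 2 = x ^+ 2 - 1 by rewrite sqr_sqrtr.
have xy : 0 < x + y by rewrite ltr_pwDl ?sqrtr_ge0 // (lt_le_trans ltr01).
rewrite expRN lnK ?posrE //.
have -> : (x + y)^-1 = x - y; last by field.
apply: (mulfI (lt0r_neq0 xy)); rewrite mulfV ?gt_eqF //.
by transitivity (x ^+ 2 - y ^+ 2); [rewrite y2|]; ring.
Qed.

Lemma lorentz_sym u v : lorentz u v = lorentz v u.
Proof. by rewrite /lorentz; ring. Qed.

Lemma lorentz_hyperboloid p : lorentz (\val p) (\val p) = -1.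
Proof. by have /andP[/eqP] := valP p. Qed.

(** The reverse Cauchy-Schwarz inequality for two vectors of the hyperboloid:
    with [m] the inner product of the spatial parts plus one, [m] is at most
    the product of the time coordinates, because the difference of the squares
    is a sum of squares. *)
Lemma lorentz_le_N1 p q : lorentz (\val p) (\val q) <= -1.
Proof.
have /andP[_ p0] := valP p; have /andP[_ q0] := valP q.
have := lorentz_hyperboloid p; have := lorentz_hyperboloid q.
move: p0 q0; rewrite /lorentz.
move: (\val p) (\val q) => u v.
set u0 := u 0 0; set u1 := u 0 1; set u2 := u 0 2.
set v0 := v 0 0; set v1 := v 0 1; set v2 := v 0 2 => u0p v0p vv uu.
set m := 1 + u1 * v1 + u2 * v2.
have m2 : m ^+ 2 <= (u0 * v0) ^+ 2.
  have -> : (u0 * v0) ^+ 2 = (1 + u1 ^+ 2 + u2 ^+ 2) * (1 + v1 ^+ 2 + v2 ^+ 2).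
    by rewrite exprMn; congr (_ * _); lra.
  rewrite -subr_ge0.
  have -> : (1 + u1 ^+ 2 + u2 ^+ 2) * (1 + v1 ^+ 2 + v2 ^+ 2) - m ^+ 2
     = (u1 - v1) ^+ 2 + (u2 - v2) ^+ 2 + (u1 * v2 - u2 * v1) ^+ 2.
    by rewrite /m; ring.
  by rewrite !addr_ge0 ?sqr_ge0.
have : m <= u0 * v0.
  rewrite (le_trans (ler_norm m)) // -(@ler_pXn2r _ 2) ?nnegrE //.
    by rewrite -normrX ger0_norm ?sqr_ge0.
  by rewrite mulr_ge0 ?ltW.
by rewrite /m; lra.
Qed.

Lemma dist_hyperbolic p q r :
  @dist _ (hyperbolic_plane R) p q = r -> lorentz (\val p) (\val q) = - cosh r.
Proof.
move=> <- /=; rewrite cosh_arcosh ?opprK //.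
by rewrite lerNr lorentz_le_N1.
Qed.

Lemma lorentzD u v w (a b : R) :
  lorentz (v + a *: u) (w + b *: u)
  = lorentz v w + b * lorentz u v + a * lorentz u w + a * b * lorentz u u.
Proof. by rewrite /lorentz !mxE; ring. Qed.

Lemma lorentz_direction p q s :
  lorentz (direction p q) (direction p s)
  = lorentz (\val q) (\val s)
    + lorentz (\val p) (\val q) * lorentz (\val p) (\val s).
Proof. by rewrite /direction lorentzD lorentz_hyperboloid; ring. Qed.

(** The hyperbolic law of cosines: the initial velocity from one point to
    another has the hyperbolic sine of their distance as its length. *)
Lemma angle_hyperbolic p q s (a b : R) : 0 < a -> 0 < b ->
  lorentz (\val p) (\val q) = - cosh a ->
  lorentz (\val p) (\val s) = - cosh b ->
  @angle _ (hyperbolic_plane R) q p s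
  = acos ((lorentz (\val q) (\val s) + cosh a * cosh b) / (sinh a * sinh b)).
Proof.
move=> a0 b0 pq ps; rewrite /= /vangle !lorentz_direction !lorentz_hyperboloid.
rewrite pq ps mulrNN !mulrNN -!expr2 !cosh2.
by rewrite !addKr !sqrtr_sqr !ger0_norm ?ltW ?sinh_gt0.
Qed.

Lemma det_rows3 u v w :
  \det (\matrix_(i < 3) tnth [tuple u; v; w] i) =
  u 0 0 * (v 0 1 * w 0 2 - v 0 2 * w 0 1)
  - u 0 1 * (v 0 0 * w 0 2 - v 0 2 * w 0 0)
  + u 0 2 * (v 0 0 * w 0 1 - v 0 1 * w 0 0).
Proof.
rewrite (expand_det_row _ ord0) !big_ord_recl big_ord0 /cofactor.
rewrite !(expand_det_row _ ord0) !big_ord_recl !big_ord0 /cofactor !det_mx11.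
rewrite !mxE !(tnth_nth 0) /= /bump /=.
(* As functions of natural numbers the entries have computable indices. *)
have [f fE] : exists f : 'rV[R]_3 -> nat -> R,
    forall (x : 'rV[R]_3) (j : 'I_3), x 0 j = f x j.
  by exists (fun x n => x 0 (inord n)) => x j; rewrite inord_val.
rewrite !fE /= /bump /=; ring.
Qed.

(** The Gram determinant of three vectors for a form of signature [(2, 1)] is
    minus the square of their determinant. *)
Lemma lorentz_gram_det u v w :
  \det (\matrix_(i < 3) tnth [tuple u; v; w] i) ^+ 2 =
  - (lorentz u u * (lorentz v v * lorentz w w - lorentz v w ^+ 2)
     - lorentz u v * (lorentz u v * lorentz w w - lorentz v w * lorentz u w)
     + lorentz u w * (lorentz u v * lorentz v w - lorentz v v * lorentz u w)).
Proof. by rewrite det_rows3 /lorentz; ring. Qed.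

(** The Cauchy-Schwarz inequality in the tangent plane at the middle point:
    the difference of the two sides is the Gram determinant up to sign. *)
Lemma lorentz_gram_le p q s :
  (lorentz (\val p) (\val s)
    + lorentz (\val p) (\val q) * lorentz (\val q) (\val s)) ^+ 2
  <= (lorentz (\val p) (\val q) ^+ 2 - 1)
     * (lorentz (\val q) (\val s) ^+ 2 - 1).
Proof.
rewrite -subr_ge0.
have := lorentz_gram_det (\val p) (\val q) (\val s).
rewrite !lorentz_hyperboloid => det2.
have := sqr_ge0 (\det (\matrix_(i < 3) tnth [tuple \val p; \val q; \val s] i)).
by rewrite det2; congr (_ <= _); ring.
Qed.

End HyperbolicTriangle.

Section HyperbolicKite.
Variable R : realType.
Implicit Types (p q s : hyperboloid R) (theta r rl rr : R).

(** The function [hyperbolic_half_angle] in terms of the radii, through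
    [e^rho = tanh (r / 2)]. *)
Definition hyperbolic_triangle_half_angle theta rl rr : R :=
  half_angle theta (tanh (rr / 2) / tanh (rl / 2))
  - half_angle theta (tanh (rr / 2) * tanh (rl / 2)).

(** With [tl] and [tr] the values [tanh (r / 2)] of the two sides, the right
    hand side is the cosine of the argument of
    [(1 - (tr / tl) e^(- i theta)) * (1 - tr tl e^(i theta))], whose real part
    is, up to a positive factor, the numerator given by the law of cosines.
    The moduli of the two factors are proportional to the square roots of
    [cosh c - 1] and [cosh c + 1], where [c] is the third side, so their
    product is proportional to [l = sinh c]. *)
Lemma cos_hyperbolic_half_angle theta rl rr (l : R) :
  0 < theta < pi -> 0 < rl -> 0 < rr -> 0 < l ->
  l ^+ 2 = (cosh rl * cosh rr - sinh rl * sinh rr * cos theta) ^+ 2 - 1 ->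
  (cosh rr * sinh rl - cosh rl * sinh rr * cos theta) / l
  = cos (hyperbolic_triangle_half_angle theta rl rr).
Proof.
move=> th0 rl0 rr0 l0 l2; rewrite /hyperbolic_triangle_half_angle.
have [] := tanh_half rl0; have [] := tanh_half rr0.
set tl := tanh (rl / 2); set tr := tanh (rr / 2).
move=> /andP[tr0 tr1] chr shr /andP[tl0 tl1] chl shl.
have Ul : 0 < 1 - tl ^+ 2 by rewrite subr_gt0 expr_lt1 // ltW.
have Ur : 0 < 1 - tr ^+ 2 by rewrite subr_gt0 expr_lt1 // ltW.
rewrite cosB !cos_half_angle // !sin_half_angle //.
have D1 := opposite_side_gt0 th0 (tr / tl).
have D2 := opposite_side_gt0 th0 (tr * tl).
have D1E := sqr_opposite_side th0 (tr / tl).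
have D2E := sqr_opposite_side th0 (tr * tl).
move: (opposite_side theta (tr / tl)) (opposite_side theta (tr * tl))
  D1 D2 D1E D2E => d1 d2 d1_gt0 d2_gt0 d1E d2E.
(* The factors of [l ^ 2 = (cosh c - 1) * (cosh c + 1)] are
   [2 tl ^ 2 d1 ^ 2] and [2 d2 ^ 2], over [(1 - tl ^ 2) * (1 - tr ^ 2)]. *)
have lE : l = 2 * tl * d1 * d2 / ((1 - tl ^+ 2) * (1 - tr ^+ 2)).
  have rhs_gt0 : 0 < 2 * tl * d1 * d2 / ((1 - tl ^+ 2) * (1 - tr ^+ 2)).
    by apply: divr_gt0; do !apply: mulr_gt0 => //.
  apply/eqP; rewrite -(@eqrXn2 _ 2) ?ltW //.
  have -> : (2 * tl * d1 * d2 / ((1 - tl ^+ 2) * (1 - tr ^+ 2))) ^+ 2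
      = (2 * tl / ((1 - tl ^+ 2) * (1 - tr ^+ 2))) ^+ 2 * (d1 ^+ 2 * d2 ^+ 2).
    by ring.
  rewrite l2 chr shr chl shl d1E d2E; apply/eqP; field.
  by rewrite !gt_eqF.
rewrite lE chr shr chl shl.
have S2 := sin2cos2 theta.
transitivity (((1 - tr / tl * cos theta) * (1 - tr * tl * cos theta)
  + tr ^+ 2 * sin theta ^+ 2) / (d1 * d2)).
  rewrite S2; field; rewrite !gt_eqF //.
by field; rewrite !gt_eqF.
Qed.

Lemma hyperbolic_half_angle_range theta rl rr :
  0 < theta < pi -> 0 < rl -> 0 < rr ->
  0 <= hyperbolic_triangle_half_angle theta rl rr <= pi.
Proof.
move=> th0 rl0 rr0; rewrite /hyperbolic_triangle_half_angle.
have [/andP[tl0 tl1] _ _] := tanh_half rl0.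
have [/andP[tr0 tr1] _ _] := tanh_half rr0.
move: (tanh (rl / 2)) (tanh (rr / 2)) tl0 tl1 tr0 tr1 => tl tr tl0 tl1 tr0 tr1.
have lt : half_angle theta (tr * tl) < half_angle theta (tr / tl).
  rewrite ltr_half_angle // ltr_pM2l // (lt_trans tl1) //.
  by rewrite invf_gt1.
have := half_angle_gt0 th0 (mulr_gt0 tr0 tl0).
have := half_angle_lt theta (tr / tl).
by move: th0 => /andP[th0 thpi]; move=> *; apply/andP; split; lra.
Qed.

Lemma hyperbolic_law_of_cosines_gt1 theta rl rr :
  0 < theta < pi -> 0 < rl -> 0 < rr ->
  1 < cosh rl * cosh rr - sinh rl * sinh rr * cos theta.
Proof.
move=> th0 rl0 rr0; have sl := sinh_gt0 rl0; have sr := sinh_gt0 rr0.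
have srl : 0 < sinh rl * sinh rr by rewrite mulr_gt0.
have c1 : cos theta < 1.
  have := sin_theta_gt0 th0 => S0.
  have := sin2cos2 theta; have := exprn_gt0 2 S0; nra.
have : 1 + sinh rl * sinh rr <= cosh rl * cosh rr.
  have cc : 0 < cosh rl * cosh rr by rewrite mulr_gt0 ?cosh_gt0.
  rewrite -(@ler_pXn2r _ 2) ?nnegrE ?(ltW cc) ?addr_ge0 ?(ltW srl) //.
  have -> : (cosh rl * cosh rr) ^+ 2 = (1 + sinh rl ^+ 2) * (1 + sinh rr ^+ 2).
    by rewrite exprMn !cosh2.
  by have := sqr_ge0 (sinh rl - sinh rr); nra.
by nra.
Qed.

Lemma cosh_onto (x : R) : 1 < x -> exists2 r, 0 < r & cosh r = x.
Proof.
move=> x1; exists (arcosh x); last by rewrite cosh_arcosh // ltW.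
by rewrite ln_gt0 // ltr_wpDr ?sqrtr_ge0.
Qed.

Lemma hyperbolic_triangle_angle p q s theta rl rr :
  0 < theta < pi -> 0 < rl -> 0 < rr ->
  @dist _ (hyperbolic_plane R) p q = rl ->
  @dist _ (hyperbolic_plane R) q s = rr ->
  @angle _ (hyperbolic_plane R) p q s = theta ->
  @angle _ (hyperbolic_plane R) q p s
  = hyperbolic_triangle_half_angle theta rl rr.
Proof.
move=> th0 rl0 rr0 /dist_hyperbolic pq /dist_hyperbolic qs.
have qp : lorentz (\val q) (\val p) = - cosh rl by rewrite lorentz_sym.
have sl := sinh_gt0 rl0; have sr := sinh_gt0 rr0.
have srl : 0 < sinh rl * sinh rr by rewrite mulr_gt0.
rewrite (angle_hyperbolic rl0 rr0 qp qs) => /(congr1 cos).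
rewrite acosK; last first.
  have := lorentz_gram_le p q s; rewrite pq qs mulrNN !sqrrN !cosh2.
  rewrite ![1 + _ - 1]addrAC subrr !add0r -exprMn => gram.
  rewrite in_itv /= -ler_norml normrM normfV (gtr0_norm srl).
  rewrite ler_pdivrMr // mul1r.
  by rewrite -(@ler_pXn2r _ 2) ?nnegrE ?normr_ge0 ?(ltW srl) // -normrX
    ger0_norm ?sqr_ge0.
move=> /(canRL (divfK (lt0r_neq0 srl))) psE.
set L := cosh rl * cosh rr - sinh rl * sinh rr * cos theta.
have ps : lorentz (\val p) (\val s) = - L by rewrite /L; lra.
have L1 : 1 < L by exact: hyperbolic_law_of_cosines_gt1.
have [c c0 cL] := cosh_onto L1.
rewrite -cL in ps.
rewrite (angle_hyperbolic rl0 c0 pq ps) qs.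
rewrite -(@cosK _ (hyperbolic_triangle_half_angle _ _ _)) ?in_itv /=;
  last first.
  exact: hyperbolic_half_angle_range.
congr acos.
rewrite -(@cos_hyperbolic_half_angle _ _ _ (sinh c)) ?sinh_gt0 //; last first.
  by rewrite -/L -cL cosh2 addrC addKr.
rewrite cL /L.
have c2 := cosh2 rl.
transitivity ((cosh rr * (cosh rl ^+ 2 - 1)
    - cosh rl * sinh rl * sinh rr * cos theta)
   / (sinh rl * sinh c)).
  by congr (_ / _); ring.
rewrite c2; field.
by rewrite !gt_eqF ?sinh_gt0.
Qed.

End HyperbolicKite.

(** * Hyperbolic patterns *)

Section HyperbolicPattern.
Variable R : realType.
Implicit Types (p q s : hyperboloid R) (theta r rl rr : R).

Definition vec3 (x y z : R) : 'rV[R]_3 :=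
  \row_j (if j == 0 then x else if j == 1 then y else z).

Lemma hyperboloid_point (x y z : R) : 0 < x -> x ^+ 2 = 1 + y ^+ 2 + z ^+ 2 ->
  exists p : hyperboloid R, \val p = vec3 x y z.
Proof.
move=> x0 xE.
have px : (lorentz (vec3 x y z) (vec3 x y z) == -1) && (0 < vec3 x y z 0 0).
  by rewrite /lorentz !mxE /= x0 andbT; apply/eqP; lra.
by exists (exist (fun u : 'rV[R]_3 => (lorentz u u == -1) && (0 < u 0 0)) _ px).
Qed.

Lemma dist_hyperbolic_sym (p q : hyperbolic_plane R) : dist p q = dist q p.
Proof. by rewrite /= lorentz_sym. Qed.

Lemma angle_hyperbolic_sym (p q s : hyperbolic_plane R) :
  angle p q s = angle s q p.
Proof.
rewrite /= /vangle [_ * Num.sqrt _]mulrC.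
by rewrite [lorentz (direction q p) _]lorentz_sym.
Qed.

(** The left center is put at the base point of the hyperboloid and the axis
    in the plane of the first two coordinates; [c] is its length. *)
Lemma hyperbolic_kite_exists theta rl rr :
  0 < theta < pi -> 0 < rl -> 0 < rr ->
  exists K : kite (hyperbolic_plane R), is_kite rl rr theta K.
Proof.
move=> th0 rl0 rr0; have S0 := sin_theta_gt0 th0.
have SE := sin2cos2 theta.
have sl := sinh_gt0 rl0; have sr := sinh_gt0 rr0.
have [c c0 cE] := cosh_onto (hyperbolic_law_of_cosines_gt1 th0 rl0 rr0).
have sc := sinh_gt0 c0.
have cl2 := cosh2 rl; have cr2 := cosh2 rr; have cc2 := cosh2 c.
pose n := cosh rr * sinh rl - cosh rl * sinh rr * cos theta.
have nE : n ^+ 2 + (sinh rr * sin theta) ^+ 2 = sinh c ^+ 2.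
  have -> : sinh c ^+ 2 = cosh c ^+ 2 - 1 by rewrite cc2 addrAC subrr add0r.
  rewrite [(_ * sin _) ^+ 2]exprMn SE cE.
  pose m := 2 * (cosh rl * cosh rr * (sinh rl * sinh rr * cos theta)).
  transitivity (cosh rr ^+ 2 * sinh rl ^+ 2 - m
      + cosh rl ^+ 2 * (sinh rr * cos theta) ^+ 2
      + sinh rr ^+ 2 * (1 - cos theta ^+ 2)); first by rewrite /n /m; ring.
  transitivity (cosh rl ^+ 2 * cosh rr ^+ 2 - m
      + (sinh rl * sinh rr * cos theta) ^+ 2 - 1); last by rewrite /m; ring.
  by rewrite cl2 cr2; ring.
pose x := sinh rl * n / sinh c.
pose y := sinh rl * sinh rr * sin theta / sinh c.
have xc : x * sinh c = sinh rl * n by rewrite divfK // gt_eqF.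
have y0 : 0 < y := divr_gt0 (mulr_gt0 (mulr_gt0 sl sr) S0) sc.
have xy : cosh rl ^+ 2 = 1 + x ^+ 2 + y ^+ 2.
  rewrite cl2 -addrA; congr (1 + _).
  have -> : x ^+ 2 + y ^+ 2
      = sinh rl ^+ 2 * (n ^+ 2 + (sinh rr * sin theta) ^+ 2) / sinh c ^+ 2.
    by rewrite /x /y; field; rewrite gt_eqF.
  by rewrite nE mulfK // expf_neq0 // gt_eqF.
have [p pE] : exists p : hyperboloid R, \val p = vec3 1 0 0.
  by apply: hyperboloid_point => //; ring.
have [q qE] : exists q : hyperboloid R, \val q = vec3 (cosh rl) x (- y).
  by apply: hyperboloid_point; rewrite ?cosh_gt0 // sqrrN.
have [q' q'E] : exists q' : hyperboloid R, \val q' = vec3 (cosh rl) x y.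
  by apply: hyperboloid_point; rewrite ?cosh_gt0.
have [s sE] : exists s : hyperboloid R, \val s = vec3 (cosh c) (sinh c) 0.
  by apply: hyperboloid_point; rewrite ?cosh_gt0 // cc2; ring.
have pq : lorentz (\val p) (\val q) = - cosh rl.
  by rewrite pE qE /lorentz !mxE /=; ring.
have pq' : lorentz (\val p) (\val q') = - cosh rl.
  by rewrite pE q'E /lorentz !mxE /=; ring.
have ps : lorentz (\val p) (\val s) = - cosh c.
  by rewrite pE sE /lorentz !mxE /=; ring.
(* The law of cosines at the left center. *)
have xcE : x * sinh c - cosh rl * cosh c = - cosh rr.
  rewrite xc cE /n.
  transitivity (cosh rr * (sinh rl ^+ 2 - cosh rl ^+ 2)); first by ring.
  by rewrite cl2; ring.
have qs : lorentz (\val q) (\val s) = - cosh rr.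
  by rewrite -xcE qE sE /lorentz !mxE /=; ring.
have q's : lorentz (\val q') (\val s) = - cosh rr.
  by rewrite -xcE q'E sE /lorentz !mxE /=; ring.
have at_q (u : hyperboloid R) :
    lorentz (\val u) (\val p) = - cosh rl ->
    lorentz (\val u) (\val s) = - cosh rr ->
    @angle _ (hyperbolic_plane R) p u s = theta.
  move=> up us; rewrite (angle_hyperbolic rl0 rr0 up us) ps cE.
  have -> : - (cosh rl * cosh rr - sinh rl * sinh rr * cos theta)
      + cosh rl * cosh rr = cos theta * (sinh rl * sinh rr) by ring.
  rewrite mulfK ?(gt_eqF (mulr_gt0 sl sr)) //.
  by rewrite cosK // in_itv /=; case/andP: th0 => /ltW -> /ltW ->.
have dE : forall (p1 p2 : hyperboloid R) (r : R), 0 < r ->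
    lorentz (\val p1) (\val p2) = - cosh r ->
    @dist _ (hyperbolic_plane R) p1 p2 = r.
  by move=> p1 p2 r r0 pp; rewrite /= pp opprK arcosh_cosh.
exists (@Kite R (hyperbolic_plane R) p q s q').
split; first split.
- exact: dE pq.
- exact: dE qs.
- by apply: dE => //; rewrite lorentz_sym.
- by apply: dE => //; rewrite lorentz_sym.
- by apply: at_q; rewrite // lorentz_sym.
- by rewrite [LHS]angle_hyperbolic_sym; apply: at_q; rewrite // lorentz_sym.
- rewrite /= det_rows3 pE qE sE !mxE /=.
  by have := mulr_gt0 y0 sc; lra.
- rewrite /= det_rows3 pE q'E sE !mxE /=.
  by have := mulr_gt0 y0 sc; lra.
Qed.

Lemma hyperbolic_circle_pattern_radiiE (S : cellular_surface)
    (theta : edge S -> R) (Phi r : face S -> R) :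
  (forall e, 0 < theta e < pi) -> (forall f, 0 < r f) ->
  circle_pattern_radii (hyperbolic_plane R) theta Phi r <->
  forall f, \sum_(d : edge S * bool | lface (inl d) == f)
    2 * hyperbolic_triangle_half_angle (theta d.1) (r (lface (inl d)))
      (r (opposite_face d))
  = Phi f.
Proof.
move=> th0 r0.
rewrite (circle_pattern_radiiE dist_hyperbolic_sym angle_hyperbolic_sym
  (@hyperbolic_triangle_angle R) hyperbolic_kite_exists Phi r th0).
by split=> [[]|].
Qed.

(** The radius is [r = ln ((1 + e^x) / (1 - e^x))]. *)
Lemma tanh_half_onto (x : R) : x < 0 ->
  exists r, 0 < r /\ x = ln (tanh (r / 2)).
Proof.
move=> x0; have e0 := expR_gt0 x; have e1 : expR x < 1 by rewrite expR_lt1.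
pose E := (1 + expR x) / (1 - expR x).
have E1 : 1 < E by rewrite /E ltr_pdivlMr ?subr_gt0 // mul1r; lra.
exists (ln E); split; first by rewrite ln_gt0.
rewrite -[LHS]expRK; congr ln.
have E0 : 0 < E by rewrite (lt_trans ltr01).
have e2 : expR (ln E / 2) ^+ 2 = E.
  by rewrite expr2 -expRD -splitr lnK.
have f0 := expR_gt0 (ln E / 2).
rewrite /tanh expRN.
transitivity ((expR (ln E / 2) ^+ 2 - 1) / (expR (ln E / 2) ^+ 2 + 1)).
  rewrite e2 /E; field; rewrite !gt_eqF //; lra.
by field; rewrite !gt_eqF ?addr_gt0 ?invr_gt0 ?mulr_gt0.
Qed.

End HyperbolicPattern.

(** * Critical points and circle patterns *)

Theorem proposition1 (R : realType) (S : cellular_surface)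
    (theta : edge S -> R) (Phi : face S -> R)
    (theta_range : forall e, 0 < theta e < pi)
    (Phi_gt0 : forall f, 0 < Phi f)
    (rho : face S -> R) :
  [/\ critical_point (S_Euc theta Phi) rho <->
        circle_pattern_radii (euclidean_plane R) theta Phi
          (fun f => expR (rho f)),
      critical_point (S_hyp theta Phi) rho -> (forall f, rho f < 0)
    & critical_point (S_hyp theta Phi) rho <->
        (forall f, rho f < 0) /\
        exists r : face S -> R,
          [/\ forall f, 0 < r f,
              forall f, rho f = ln (tanh (r f / 2))
            & circle_pattern_radii (hyperbolic_plane R) theta Phi r]].
Proof.
have crit_hyp : critical_point (S_hyp theta Phi) rho -> forall f, rho f < 0.
  move=> /(critical_point_gradient (gradient_S_hyp Phi theta_range rho)) crit f.
  rewrite ltNge; apply/negP => rho_f.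
  have /eqP := crit f; rewrite subr_eq0 => /eqP PhiE.
  (* If [rho f >= 0], no term of the sum for [f] is positive. *)
  have := Phi_gt0 f; rewrite PhiE ltNge => /negP; apply.
  apply: sumr_le0 => d /eqP df; rewrite pmulr_rle0 // subr_le0 df.
  rewrite leNgt ltr_half_angle // -leNgt ler_expR; lra.
split; [|exact: crit_hyp|].
- rewrite (critical_point_gradient (gradient_S_Euc Phi theta_range rho)).
  rewrite euclidean_circle_pattern_radiiE //; last by move=> f; exact: expR_gt0.
  have sumE f : \sum_(d : edge S * bool | lface (inl d) == f)
      2 * euclidean_half_angle (theta d.1) (rho (lface (inl d)))
        (rho (opposite_face d))
    = \sum_(d : edge S * bool | lface (inl d) == f)
      2 * half_angle (theta d.1)
        (expR (rho (opposite_face d)) / expR (rho (lface (inl d)))).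
    by apply: eq_bigr => d _; rewrite /euclidean_half_angle expRD expRN.
  by split=> H f; have /eqP := H f; rewrite sumE ?subr_eq0 => /eqP //= ->;
     rewrite ?subrr.
have hypE (r : face S -> R) : (forall f, 0 < r f) ->
    (forall f, rho f = ln (tanh (r f / 2))) ->
    critical_point (S_hyp theta Phi) rho <->
    circle_pattern_radii (hyperbolic_plane R) theta Phi r.
  move=> r0 rE.
  have tE f : expR (rho f) = tanh (r f / 2).
    by rewrite rE lnK // posrE; have [/andP[]] := tanh_half (r0 f).
  rewrite (critical_point_gradient (gradient_S_hyp Phi theta_range rho)).
  rewrite hyperbolic_circle_pattern_radiiE //.
  have sumE f : \sum_(d : edge S * bool | lface (inl d) == f)
      2 * hyperbolic_half_angle (theta d.1) (rho (lface (inl d)))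
        (rho (opposite_face d))
    = \sum_(d : edge S * bool | lface (inl d) == f)
      2 * hyperbolic_triangle_half_angle (theta d.1) (r (lface (inl d)))
        (r (opposite_face d)).
    apply: eq_bigr => d _; rewrite /hyperbolic_half_angle.
    by rewrite /hyperbolic_triangle_half_angle !expRD expRN !tE.
  by split=> H f; have /eqP := H f; rewrite sumE ?subr_eq0 => /eqP //= ->;
     rewrite ?subrr.
split=> [crit|[_ [r [r0 rE cp]]]]; last exact/(hypE r).
split; first exact: crit_hyp.
have [r r_spec] := choice (fun f => tanh_half_onto (crit_hyp crit f)).
exists r; split=> [f|f|]; [by have [] := r_spec f|by have [] := r_spec f|].
by apply/hypE => // f; have [] := r_spec f.
Qed.
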